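(* Let $B>0$ and let $A,C$ be real constants, and let $$f=\sqrt{1+\frac{\sqrt{1+Br^2}\,C}{r^4}+\frac{A}{r^4}} .$$ Suppose $v(r)$ is a smooth function such that the metric $$\tilde g=-v^2dt^2+\frac{dr^2}{(1+Br^2)f^2}+r^2\big(\sigma_1^2+\sigma_2^2+f^2\sigma_3^2\big)$$ satisfies the 5-dimensional vacuum Einstein equations with negative cosmological constant $\Lambda$, $$\tilde R_{ij}=\tfrac23\Lambda\,\tilde g_{ij},\qquad 0\leq i,j\leq4 .$$ Then $$v=\sqrt{1+Br^2},\qquad C=0 .$$
   Context: $\theta,\phi,\psi$ are Euler angles on $S^3$ (or on a quotient $S^3/\mathbb{Z}_n$), and $$\sigma_1=\tfrac12(\sin\psi\,d\theta-\sin\theta\cos\psi\,d\phi),\quad \sigma_2=\tfrac12(-\cos\psi\,d\theta-\sin\theta\sin\psi\,d\phi),\quad \sigma_3=\tfrac12(d\psi+\cos\theta\,d\phi)$$ are the Cartan-Maurer one-forms, which satisfy $d\sigma_1=2\sigma_2\wedge\sigma_3$, $d\sigma_2=2\sigma_3\wedge\sigma_1$, $d\sigma_3=2\sigma_1\wedge\sigma_2$. $\tilde R_{ij}$ is the Ricci tensor of $\tilde g$, $t$ is the time coordinate, and $r>0$ is the radial coordinate, ranging where the expression under the square root defining $f$ is positive.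
   Formalization: The conclusion v = √(1+Br²) is replaced by v = c√(1+Br²) for one constant c ≠ 0, because rescaling t turns any solution v into cv (e.g. A = C = 0, B = 1, Λ = −6, v = 2√(1+r²)); C = 0 is proved as stated. *)

(* Defs.v *)
From Stdlib Require Import Reals Arith.
From Coquelicot Require Import Coquelicot.
Open Scope R_scope.

(** * Ricci curvature of a pseudo-Riemannian metric in a chart of dimension 5

    Points are coordinate tuples [x 0, ..., x 4].  Only the indices [0..4] are
    meaningful: every sum and every condition below is limited to them, and the
    values of points and tensors at larger indices play no role. *)

Definition point := nat -> R.

Definition upd (x : point) (k : nat) (s : R) : point :=
  fun i => if Nat.eqb i k then s else x i.

Definition partial (k : nat) (F : point -> R) (x : point) : R :=
  Derive (fun s => F (upd x k s)) (x k).

(* [sum_f_R0 a 4] is [a 0 + ... + a 4]. *)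
Definition sum5 (a : nat -> R) : R := sum_f_R0 a 4.

Definition kronecker (i j : nat) : R := if Nat.eqb i j then 1 else 0.

Definition tensor2 := point -> nat -> nat -> R.

Definition inverse_on (U : point -> Prop) (g ginv : tensor2) : Prop :=
  forall x, U x -> forall i j, (i <= 4)%nat -> (j <= 4)%nat ->
    sum5 (fun k => g x i k * ginv x k j) = kronecker i j.

(* Gamma^k_{ij} = (1/2) g^{kl} (d_i g_{jl} + d_j g_{il} - d_l g_{ij}) *)
Definition christoffel (g ginv : tensor2) (k i j : nat) (x : point) : R :=
  / 2 * sum5 (fun l => ginv x k l *
    (partial i (fun y => g y j l) x + partial j (fun y => g y i l) x
     - partial l (fun y => g y i j) x)).

(* R_{ij} = d_k Gamma^k_{ij} - d_j Gamma^k_{ik}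
            + Gamma^k_{kl} Gamma^l_{ij} - Gamma^k_{jl} Gamma^l_{ik};
   with this sign the round spheres have positive Ricci curvature. *)
Definition ricci (g ginv : tensor2) (x : point) (i j : nat) : R :=
  let Gam := christoffel g ginv in
  sum5 (fun k =>
    partial k (Gam k i j) x - partial j (Gam k i k) x
    + sum5 (fun l => Gam k k l x * Gam l i j x - Gam k j l x * Gam l i k x)).

(* [g] is nondegenerate on [U] and Ric = lam * g there.  A pointwise inverse
   matrix is unique, so on an open [U] the condition does not depend on which
   [ginv] is chosen. *)
Definition einstein_on (U : point -> Prop) (g : tensor2) (lam : R) : Prop :=
  exists ginv : tensor2, inverse_on U g ginv /\
    forall x, U x -> forall i j, (i <= 4)%nat -> (j <= 4)%nat ->
      ricci g ginv x i j = lam * g x i j.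

(** * The coordinates (t, r, theta, phi, psi) and the Cartan-Maurer forms

    A one-form is given by its components: [omega x i] is the coefficient of the
    differential of the [i]-th coordinate. *)

Definition tcoord : nat := 0.
Definition rcoord : nat := 1.
Definition theta : nat := 2.
Definition phi : nat := 3.
Definition psi : nat := 4.

Definition oneform := point -> nat -> R.

Definition dcoord (k : nat) : oneform := fun _ i => kronecker k i.

Definition sigma1 : oneform := fun x i =>
  / 2 * (sin (x psi) * dcoord theta x i
         - sin (x theta) * cos (x psi) * dcoord phi x i).

Definition sigma2 : oneform := fun x i =>
  / 2 * (- cos (x psi) * dcoord theta x i
         - sin (x theta) * sin (x psi) * dcoord phi x i).

Definition sigma3 : oneform := fun x i =>
  / 2 * (dcoord psi x i + cos (x theta) * dcoord phi x i).

Definition sq (omega : oneform) : tensor2 := fun x i j => omega x i * omega x j.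

(** * The metric *)

Definition radicand (A B C r : R) : R :=
  1 + sqrt (1 + B * r ^ 2) * C / r ^ 4 + A / r ^ 4.

Definition f (A B C r : R) : R := sqrt (radicand A B C r).

Definition rdom (A B C r : R) : Prop := 0 < r /\ 0 < radicand A B C r.

(* The Euler angles are coordinates where 0 < theta < PI, a dense set.  The
   angles phi and psi are not identified periodically: the Einstein equations
   are local, so S^3 and S^3/Z_n are treated alike. *)
Definition chart (A B C : R) (x : point) : Prop :=
  rdom A B C (x rcoord) /\ 0 < x theta < PI.

Definition gtilde (A B C : R) (v : R -> R) : tensor2 := fun x i j =>
  let r := x rcoord in
  - v r ^ 2 * sq (dcoord tcoord) x i j
  + / ((1 + B * r ^ 2) * f A B C r ^ 2) * sq (dcoord rcoord) x i j
  + r ^ 2 * (sq sigma1 x i j + sq sigma2 x i j + f A B C r ^ 2 * sq sigma3 x i j).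

Definition smooth_on (D : R -> Prop) (v : R -> R) : Prop :=
  forall (n : nat) (r : R), D r -> ex_derive_n v n r.

(* Main.v *)
Require Import Defs.
From Stdlib Require Import Reals Lra Lia.
From Coquelicot Require Import Coquelicot.
Open Scope R_scope.

(** Since [sigma1^2 + sigma2^2 = (dtheta^2 + sin^2 theta dphi^2) / 4], the metric
    is the diagonal part [gtt dt^2 + grr dr^2 + base (dtheta^2 + sin^2 theta dphi^2)]
    plus [fibre (dpsi + cos theta dphi)^2], where the four coefficients depend on
    [r] alone.  So its curvature is a matter of ordinary differential equations
    in [r], and two of the Einstein equations suffice, R_tt and R_theta,theta.

    Write [x = sqrt (1 + B r^2)], [F = f^2], [lam = 2/3 Lambda] and
    [mu = lam + 3 B].  The theta-theta equation contains [v] only through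
    [v' / v].  Its remaining terms collapse, because the [C]-part of [F] drops
    out, and it becomes
      [v' / v = (B A - mu r^4) / (r^3 x^2 F)]        ([lapse_ode]).
    Inserting this in the tt equation eliminates [v] and leaves a relation
    between [r], [x] and the constants ([time_constraint]).  Its leading
    coefficient as [r] tends to infinity must vanish
    ([asymptotic_constraint]):
      [(lam - 3 mu) B + mu^2 = 0],  that is  [lam (lam + 4 B) = 0].
    As [lam < 0], [lam = - 4 B].  The relation then factors as
      [B^2 F_0 (F_0 - F) = 0]  with  [F_0 = 1 + A / r^4],
    and [F - F_0 = C x / r^4], so [C = 0].  Finally [F = F_0] turns the equation
    for [v] into [v' / v = B r / x^2 = x' / x].  With [C = 0] the domain
    [r^4 + A > 0] is an interval, and [v / x] is constant on it. *)

(** * Metrics on a static spacetime with Berger spheres *)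

(** The metrics [gtt dt^2 + grr dr^2 + base (dtheta^2 + sin^2 theta dphi^2)
    + fibre (dpsi + cos theta dphi)^2], given by their coefficient functions
    of the radius. *)
Record profile := Profile
  { gtt : R -> R; grr : R -> R; base : R -> R; fibre : R -> R }.

Definition biaxial (p : profile) (i j : nat) (r th : R) : R :=
  match i, j with
  | 0%nat, 0%nat => gtt p r
  | 1%nat, 1%nat => grr p r
  | 2%nat, 2%nat => base p r
  | 3%nat, 3%nat => base p r * sin th ^ 2 + fibre p r * cos th ^ 2
  | 3%nat, 4%nat | 4%nat, 3%nat => fibre p r * cos th
  | 4%nat, 4%nat => fibre p r
  | _, _ => 0
  end.

Definition biaxial_inv (p : profile) (i j : nat) (r th : R) : R :=
  match i, j with
  | 0%nat, 0%nat => / gtt p r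
  | 1%nat, 1%nat => / grr p r
  | 2%nat, 2%nat => / base p r
  | 3%nat, 3%nat => / (base p r * sin th ^ 2)
  | 3%nat, 4%nat | 4%nat, 3%nat => - cos th / (base p r * sin th ^ 2)
  | 4%nat, 4%nat => / fibre p r + cos th ^ 2 / (base p r * sin th ^ 2)
  | _, _ => 0
  end.

(** The derivative of [biaxial p i j] in the [k]-th coordinate.  For the radius it
    is [biaxial] again, at the differentiated profile, since the components are
    linear in the profile. *)
Definition dbiaxial (p : profile) (k i j : nat) (r th : R) : R :=
  match k with
  | 1%nat => biaxial (Profile (Derive (gtt p)) (Derive (grr p))
                       (Derive (base p)) (Derive (fibre p))) i j r th
  | 2%nat =>
      match i, j with
      | 3%nat, 3%nat => 2 * (base p r - fibre p r) * sin th * cos th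
      | 3%nat, 4%nat | 4%nat, 3%nat => - fibre p r * sin th
      | _, _ => 0
      end
  | _ => 0
  end.

(** The Christoffel symbols, kept as the defining sum: individual symbols are
    evaluated only where a component of the Ricci tensor needs them. *)
Definition biaxial_gamma (p : profile) (k i j : nat) (r th : R) : R :=
  / 2 * sum5 (fun l => biaxial_inv p k l r th *
    (dbiaxial p i j l r th + dbiaxial p j i l r th - dbiaxial p l i j r th)).

Definition regular_on (D : R -> Prop) (p : profile) : Prop :=
  forall r, D r ->
    (gtt p r <> 0 /\ grr p r <> 0 /\ base p r <> 0 /\ fibre p r <> 0) /\
    (ex_derive (gtt p) r /\ ex_derive (grr p) r /\
     ex_derive (base p) r /\ ex_derive (fibre p) r).

Definition angular_chart (D : R -> Prop) (x : point) : Prop :=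
  D (x rcoord) /\ 0 < x theta < PI.

(** Functions on the chart that depend on [r] and [theta] only are handled as
    functions of two real variables; this is their [k]-th partial derivative. *)
Definition chart_partial (k : nat) (Phi : R -> R -> R) (r th : R) : R :=
  match k with
  | 1%nat => Derive (fun s => Phi s th) r
  | 2%nat => Derive (fun s => Phi r s) th
  | _ => 0
  end.

Ltac index i := destruct i as [|[|[|[|[|i]]]]]; try lia.

Lemma sum5_ext (a b : nat -> R) :
  (forall k, (k <= 4)%nat -> a k = b k) -> sum5 a = sum5 b.
Proof. intros H; apply sum_eq; exact H. Qed.

(** The chart is open in the [r] and [theta] directions and invariant in the other
    three, so an identity on the chart may be differentiated in all five.  This
    applies both to the metric and to its Christoffel symbols. *)
Lemma partial_of_chart (D : R -> Prop) (F : point -> R) (Phi : R -> R -> R)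
  (x : point) (k : nat) :
  (forall r, D r -> locally r D) ->
  (forall y, angular_chart D y -> F y = Phi (y rcoord) (y theta)) ->
  angular_chart D x -> (k <= 4)%nat ->
  partial k F x = chart_partial k Phi (x rcoord) (x theta).
Proof.
  intros HD HF [Hr Hth] Hk.
  assert (Hloc : locally (x k) (fun s => angular_chart D (upd x k s))).
  { destruct (Nat.eq_dec k 1) as [->|n1]; [|destruct (Nat.eq_dec k 2) as [->|n2]].
    - refine (filter_imp _ _ _ (HD _ Hr)); intros s Hs; split; [exact Hs|exact Hth].
    - refine (filter_imp _ _ _ (filter_and _ _ (open_gt 0 _ (proj1 Hth))
                          (open_lt PI _ (proj2 Hth)))); intros s Hs.
      split; [exact Hr|exact Hs].
    - apply filter_forall; intros s; split; unfold upd, rcoord, theta in *;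
        index k; assumption. }
  unfold partial.
  rewrite (Derive_ext_loc _ (fun s => Phi (upd x k s rcoord) (upd x k s theta))).
  - index k; cbn; try reflexivity; apply Derive_const.
  - refine (filter_imp _ _ _ Hloc); intros s; apply HF.
Qed.

Lemma chart_partial_biaxial (D : R -> Prop) (p : profile) (k i j : nat) (r th : R) :
  regular_on D p -> D r -> (k <= 4)%nat -> (i <= 4)%nat -> (j <= 4)%nat ->
  chart_partial k (biaxial p i j) r th = dbiaxial p k i j r th.
Proof.
  intros Hp Hr Hk Hi Hj.
  destruct (Hp r Hr) as [_ (E0 & E1 & E2 & E3)].
  index k; cbn [chart_partial dbiaxial]; try reflexivity;
  apply is_derive_unique; index i; index j; cbn;
    try apply is_derive_const; auto_derive; try tauto;
    repeat match goal with
           | |- context [fun s : R => ?h s] => change (fun s : R => h s) with h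
           end; ring.
Qed.

Lemma biaxial_inv_left (D : R -> Prop) (p : profile) (i j : nat) (r th : R) :
  regular_on D p -> D r -> 0 < th < PI -> (i <= 4)%nat -> (j <= 4)%nat ->
  sum5 (fun k => biaxial_inv p i k r th * biaxial p k j r th) = kronecker i j.
Proof.
  intros Hp Hr Hth Hi Hj.
  destruct (Hp r Hr) as [(N0 & N1 & N2 & N3) _].
  assert (Hs := sin_gt_0 th (proj1 Hth) (proj2 Hth)).
  index i; index j; cbn; field; repeat split; (assumption || lra).
Qed.

Lemma inverse_unique (L M N : nat -> nat -> R) :
  (forall i j, (i <= 4)%nat -> (j <= 4)%nat ->
     sum5 (fun k => L i k * M k j) = kronecker i j) ->
  (forall i j, (i <= 4)%nat -> (j <= 4)%nat ->
     sum5 (fun k => M i k * N k j) = kronecker i j) ->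
  forall i j, (i <= 4)%nat -> (j <= 4)%nat -> N i j = L i j.
Proof.
  intros HL HM i j Hi Hj.
  transitivity (sum5 (fun l => kronecker i l * N l j)).
  - unfold sum5; index i; cbn; ring.
  - transitivity (sum5 (fun k => L i k * kronecker k j)).
    + rewrite (sum5_ext _ (fun l => sum5 (fun k => L i k * M k l) * N l j))
        by (intros l Hl; now rewrite HL).
      rewrite (sum5_ext (fun k => L i k * kronecker k j)
                 (fun k => L i k * sum5 (fun l => M k l * N l j)))
        by (intros k Hk; now rewrite HM).
      unfold sum5; cbn; ring.
    + unfold sum5; index j; cbn; ring.
Qed.

Definition is_biaxial (D : R -> Prop) (p : profile) (g : tensor2) : Prop :=
  forall x, angular_chart D x -> forall i j, (i <= 4)%nat -> (j <= 4)%nat ->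
    g x i j = biaxial p i j (x rcoord) (x theta).

(** The inverse metric is known only through [inverse_on]; it is the explicit one
    because a right inverse agrees with any left inverse. *)
Lemma christoffel_biaxial (D : R -> Prop) (p : profile) (g ginv : tensor2)
  (x : point) (k i j : nat) :
  (forall r, D r -> locally r D) -> regular_on D p -> is_biaxial D p g ->
  inverse_on (angular_chart D) g ginv -> angular_chart D x ->
  (k <= 4)%nat -> (i <= 4)%nat -> (j <= 4)%nat ->
  christoffel g ginv k i j x = biaxial_gamma p k i j (x rcoord) (x theta).
Proof.
  intros HD Hp Hg Hinv Hx Hk Hi Hj.
  unfold christoffel, biaxial_gamma; f_equal; apply sum5_ext; intros l Hl.
  assert (Hdg : forall a b c, (a <= 4)%nat -> (b <= 4)%nat -> (c <= 4)%nat ->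
    partial a (fun y => g y b c) x = dbiaxial p a b c (x rcoord) (x theta)).
  { intros a b c Ha Hb Hc.
    rewrite (partial_of_chart D _ (biaxial p b c)); trivial.
    - apply (chart_partial_biaxial D); trivial; apply Hx.
    - intros y Hy; now apply Hg. }
  rewrite !Hdg by assumption; f_equal.
  apply (inverse_unique (fun i j => biaxial_inv p i j (x rcoord) (x theta)) (g x));
    trivial.
  - intros a b Ha Hb.
    rewrite (sum5_ext _ (fun m => biaxial_inv p a m (x rcoord) (x theta) *
                                  biaxial p m b (x rcoord) (x theta)))
      by (intros m Hm; now rewrite Hg).
    now apply (biaxial_inv_left D); try apply Hx.
  - intros a b; now apply Hinv.
Qed.

Lemma ricci_biaxial (D : R -> Prop) (p : profile) (g ginv : tensor2)
  (x : point) (i j : nat) :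
  (forall r, D r -> locally r D) -> regular_on D p -> is_biaxial D p g ->
  inverse_on (angular_chart D) g ginv -> angular_chart D x ->
  (i <= 4)%nat -> (j <= 4)%nat ->
  ricci g ginv x i j =
  let G k i j := biaxial_gamma p k i j (x rcoord) (x theta) in
  sum5 (fun k =>
    chart_partial k (biaxial_gamma p k i j) (x rcoord) (x theta)
    - chart_partial j (biaxial_gamma p k i k) (x rcoord) (x theta)
    + sum5 (fun l => G k k l * G l i j - G k j l * G l i k)).
Proof.
  intros HD Hp Hg Hinv Hx Hi Hj; unfold ricci; cbv zeta.
  assert (HG : forall y a b c, angular_chart D y ->
    (a <= 4)%nat -> (b <= 4)%nat -> (c <= 4)%nat ->
    christoffel g ginv a b c y = biaxial_gamma p a b c (y rcoord) (y theta))
    by (intros; now apply (christoffel_biaxial D)).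
  assert (HP : forall a b c d, (a <= 4)%nat -> (b <= 4)%nat -> (c <= 4)%nat ->
    (d <= 4)%nat -> partial d (christoffel g ginv a b c) x =
      chart_partial d (biaxial_gamma p a b c) (x rcoord) (x theta))
    by (intros; apply (partial_of_chart D); auto).
  apply sum5_ext; intros k Hk; rewrite !HP by assumption; f_equal.
  apply sum5_ext; intros l Hl; now rewrite !HG.
Qed.

(** * The Ricci components R_tt and R_theta,theta *)

(** The contraction [sum_k Gamma^k_{kr}], which is the logarithmic radial
    derivative of the volume density. *)
Definition log_volume' (p : profile) (r : R) : R :=
  Derive (gtt p) r / (2 * gtt p r) + Derive (grr p) r / (2 * grr p r)
  + Derive (base p) r / base p r + Derive (fibre p) r / (2 * fibre p r).

Ltac christoffel_by N :=
  unfold biaxial_gamma, sum5, sum_f_R0, dbiaxial, biaxial, biaxial_inv;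
  cbn [gtt grr base fibre]; N.

(** Only [Gamma^r_tt = - gtt' / (2 grr)] and [Gamma^t_tr = gtt' / (2 gtt)]
    enter besides the contraction [log_volume']. *)
Lemma ricci_biaxial_tt (D : R -> Prop) (p : profile) (g ginv : tensor2)
  (x : point) :
  (forall r, D r -> locally r D) -> regular_on D p -> is_biaxial D p g ->
  inverse_on (angular_chart D) g ginv -> angular_chart D x ->
  ricci g ginv x 0 0 =
  let r := x rcoord in
  - Derive (fun s => Derive (gtt p) s / (2 * grr p s)) r
  - Derive (gtt p) r / (2 * grr p r) *
    (log_volume' p r - Derive (gtt p) r / gtt p r).
Proof.
  intros HD Hp Hg Hinv [Hr Hth].
  rewrite (ricci_biaxial D p) by (solve [assumption | lia | now split]).
  cbv zeta; set (r := x rcoord) in *; set (th := x theta) in *.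
  destruct (Hp r Hr) as [(N0 & N1 & N2 & N3) _].
  assert (Hs := sin_gt_0 th (proj1 Hth) (proj2 Hth)).
  unfold sum5 at 1; cbn [sum_f_R0 chart_partial].
  rewrite (Derive_ext_loc (fun s => biaxial_gamma p 1 0 0 s th)
    (fun s => - (Derive (gtt p) s / (2 * grr p s)))).
  2:{ refine (filter_imp _ _ _ (HD r Hr)); intros s Hsd.
      destruct (Hp s Hsd) as [(M0 & M1 & M2 & M3) _].
      christoffel_by ltac:(field; repeat split; (assumption || lra)). }
  rewrite Derive_opp.
  rewrite (Derive_ext (fun s => biaxial_gamma p 2 0 0 r s) (fun _ => 0))
    by (intros; christoffel_by ltac:(unfold Rdiv; ring)).
  rewrite Derive_const.
  unfold log_volume'.
  set (W := Derive (fun s => _) _).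
  christoffel_by ltac:(field; repeat split; (assumption || lra)).
Qed.

(** At the equator [theta = PI / 2] all terms in [cos theta] disappear.  The
    symbols [Gamma^k_{theta k}] sum to [cot theta], whose derivative there gives
    the curvature [1] of the unit two-sphere; the twist of the fibre over it
    contributes [- fibre / (2 base)]. *)
Lemma ricci_biaxial_thth (D : R -> Prop) (p : profile) (g ginv : tensor2)
  (x : point) :
  (forall r, D r -> locally r D) -> regular_on D p -> is_biaxial D p g ->
  inverse_on (angular_chart D) g ginv -> angular_chart D x -> x theta = PI / 2 ->
  ricci g ginv x 2 2 =
  let r := x rcoord in
  1 - fibre p r / (2 * base p r)
  - Derive (fun s => Derive (base p) s / (2 * grr p s)) r
  - Derive (base p) r / (2 * grr p r) *
    (log_volume' p r - Derive (base p) r / base p r).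
Proof.
  intros HD Hp Hg Hinv [Hr Hth] Heq.
  rewrite (ricci_biaxial D p) by (solve [assumption | lia | now split]).
  cbv zeta; rewrite Heq; set (r := x rcoord) in *; clear Hth.
  destruct (Hp r Hr) as [(N0 & N1 & N2 & N3) _].
  unfold sum5 at 1; cbn [sum_f_R0 chart_partial].
  assert (Hloc : locally (PI / 2) (fun s => 0 < sin s)).
  { assert (c : continuous sin (PI / 2)) by
      (apply (ex_derive_continuous sin); auto_derive; exact I).
    apply c, open_gt; rewrite sin_PI2; lra. }
  rewrite (Derive_ext_loc (fun s => biaxial_gamma p 1 2 2 s (PI / 2))
    (fun s => - (Derive (base p) s / (2 * grr p s)))).
  2:{ refine (filter_imp _ _ _ (HD r Hr)); intros s Hsd.
      destruct (Hp s Hsd) as [(M0 & M1 & M2 & M3) _].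
      unfold biaxial_gamma, sum5, sum_f_R0, dbiaxial, biaxial, biaxial_inv;
      cbn [gtt grr base fibre]. rewrite ?sin_PI2, ?cos_PI2.
      field; repeat split; (assumption || lra). }
  rewrite Derive_opp.
  assert (Hcot : forall k, is_derive (fun s => k * (cos s / sin s)) (PI / 2) (- k)).
  { intros k; auto_derive; rewrite ?sin_PI2, ?cos_PI2; [lra|field]. }
  rewrite (Derive_ext (fun s => biaxial_gamma p 0 2 0 r s) (fun _ => 0))
    by (intros; christoffel_by ltac:(unfold Rdiv; ring)).
  rewrite (Derive_ext (fun s => biaxial_gamma p 1 2 1 r s) (fun _ => 0))
    by (intros; christoffel_by ltac:(unfold Rdiv; ring)).
  rewrite (Derive_ext (fun s => biaxial_gamma p 2 2 2 r s) (fun _ => 0))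
    by (intros; christoffel_by ltac:(unfold Rdiv; ring)).
  rewrite !Derive_const.
  rewrite (Derive_ext_loc (fun s => biaxial_gamma p 3 2 3 r s)
    (fun s => (1 - fibre p r / (2 * base p r)) * (cos s / sin s))).
  2:{ refine (filter_imp _ _ _ Hloc); intros s Hs.
      christoffel_by ltac:(field; repeat split; (assumption || lra)). }
  rewrite (Derive_ext_loc (fun s => biaxial_gamma p 4 2 4 r s)
    (fun s => fibre p r / (2 * base p r) * (cos s / sin s))).
  2:{ refine (filter_imp _ _ _ Hloc); intros s Hs.
      christoffel_by ltac:(field; repeat split; (assumption || lra)). }
  rewrite !(is_derive_unique _ _ _ (Hcot _)).
  unfold log_volume'.
  set (W := Derive (fun s => _) _).
  unfold biaxial_gamma, sum5, sum_f_R0, dbiaxial, biaxial, biaxial_inv;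
  cbn [gtt grr base fibre]; rewrite ?sin_PI2, ?cos_PI2.
  field; repeat split; (assumption || lra).
Qed.

(** * The two Einstein equations of the ansatz *)

Definition ansatz (A B C : R) (v : R -> R) : profile := Profile
  (fun r => - v r ^ 2)
  (fun r => / ((1 + B * r ^ 2) * radicand A B C r))
  (fun r => r ^ 2 / 4)
  (fun r => r ^ 2 * radicand A B C r / 4).

Definition radicand' (A B C r : R) : R :=
  let x := sqrt (1 + B * r ^ 2) in
  C * B / (x * r ^ 3) - 4 * (C * x + A) / r ^ 5.

Definition equator (r : R) : point :=
  fun i => if Nat.eqb i rcoord then r else PI / 2.

Lemma equator_chart (A B C r : R) : rdom A B C r -> chart A B C (equator r).
Proof. intros Hr; split; [exact Hr|cbn; generalize PI_RGT_0; lra]. Qed.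

Lemma warp_pos (B r : R) : 0 < B -> 0 < 1 + B * r ^ 2.
Proof. intros HB; generalize (pow2_ge_0 r); nra. Qed.

Lemma is_derive_radicand (A B C r : R) : 0 < B -> 0 < r ->
  is_derive (radicand A B C) r (radicand' A B C r).
Proof.
  intros HB Hr; unfold radicand, radicand'.
  assert (Hs := warp_pos B r HB); assert (Hx := sqrt_lt_R0 _ Hs).
  auto_derive.
  - change (1 + B * (r * (r * 1))) with (1 + B * r ^ 2).
    change (r * (r * (r * (r * 1)))) with (r ^ 4).
    repeat split; trivial; apply Rgt_not_eq, pow_lt; trivial.
  - change (r * (r * 1)) with (r ^ 2).
    set (x := sqrt _) in *; field; lra.
Qed.

Lemma rdom_open (A B C r : R) : 0 < B -> rdom A B C r -> locally r (rdom A B C).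
Proof.
  intros HB [Hr HF].
  assert (c : continuous (radicand A B C) r) by
    (apply (ex_derive_continuous (radicand A B C)); eexists;
        now apply is_derive_radicand).
  apply (filter_and (fun s => 0 < s) (fun s => 0 < radicand A B C s)).
  - now apply open_gt.
  - exact (c _ (open_gt 0 _ HF)).
Qed.

(** The angle [psi] disappears from [sigma1^2 + sigma2^2] by
    [sin^2 psi + cos^2 psi = 1]. *)
Lemma gtilde_biaxial (A B C : R) (v : R -> R) :
  is_biaxial (rdom A B C) (ansatz A B C v) (gtilde A B C v).
Proof.
  intros x [[Hr HF] _] i j Hi Hj.
  assert (Hf : Defs.f A B C (x rcoord) ^ 2 = radicand A B C (x rcoord))
    by (unfold Defs.f; apply pow2_sqrt; lra).
  unfold gtilde; rewrite Hf.
  assert (Hpsi : sin (x psi) ^ 2 = 1 - cos (x psi) ^ 2)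
    by (generalize (sin2_cos2 (x psi)); unfold Rsqr; lra).
  unfold sq, sigma1, sigma2, sigma3, dcoord, kronecker, ansatz, biaxial;
    cbn [gtt grr base fibre].
  generalize (/ ((1 + B * x rcoord ^ 2) * radicand A B C (x rcoord))).
  intros q; index i; index j; cbn -[pow Rinv]; field [Hpsi].
Qed.

Lemma regular_ansatz (A B C : R) (v : R -> R) : 0 < B ->
  (forall r, rdom A B C r -> v r <> 0 /\ ex_derive v r) ->
  regular_on (rdom A B C) (ansatz A B C v).
Proof.
  intros HB Hv r Hr; destruct (Hv r Hr) as [Hv0 Hv1]; destruct Hr as [Hr HF].
  assert (Hs := warp_pos B r HB).
  assert (HdF : ex_derive (radicand A B C) r)
    by (eexists; now apply is_derive_radicand).
  cbn -[pow]; repeat split; try (auto_derive; repeat split; trivial; fail).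
  - apply Ropp_neq_0_compat, Rmult_integral_contrapositive_currified; lra.
  - apply Rinv_neq_0_compat, Rmult_integral_contrapositive_currified; lra.
  - apply Rgt_not_eq, Rdiv_lt_0_compat; [now apply pow_lt|lra].
  - apply Rgt_not_eq, Rdiv_lt_0_compat; [|lra].
    now apply Rmult_lt_0_compat; [apply pow_lt|].
  - auto_derive; repeat split; trivial.
    apply Rmult_integral_contrapositive_currified; lra.
Qed.

Lemma Derive_gtt (A B C : R) (v : R -> R) (r : R) : ex_derive v r ->
  Derive (gtt (ansatz A B C v)) r = - 2 * v r * Derive v r.
Proof.
  intros Hv; apply is_derive_unique; cbn -[pow]; auto_derive.
  - repeat split; exact Hv.
  - change (fun s : R => v s) with v; ring.
Qed.

Lemma Derive_base (A B C : R) (v : R -> R) (r : R) : Derive (base (ansatz A B C v)) r = r / 2.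
Proof. apply is_derive_unique; cbn; auto_derive; trivial; field. Qed.

(** The function [F] cancels between [grr] and [fibre], so no derivative of the
    radicand is left. *)
Lemma log_volume'_ansatz (A B C : R) (v : R -> R) (r : R) : 0 < B ->
  rdom A B C r -> ex_derive v r -> v r <> 0 ->
  log_volume' (ansatz A B C v) r
  = Derive v r / v r - B * r / (1 + B * r ^ 2) + 3 / r.
Proof.
  intros HB [Hr0 HF] Hv Hv0.
  assert (Hs := warp_pos B r HB).
  assert (HdF := is_derive_radicand A B C r HB Hr0).
  unfold log_volume'; rewrite Derive_gtt, Derive_base by trivial.
  replace (Derive (grr (ansatz A B C v)) r) with
    (- (2 * B * r * radicand A B C r + (1 + B * r ^ 2) * radicand' A B C r)
     / ((1 + B * r ^ 2) * radicand A B C r) ^ 2).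
  2:{ symmetry; apply is_derive_unique; cbn -[pow]; auto_derive.
      - split; [eexists; exact HdF|split; [|exact I]].
        apply Rmult_integral_contrapositive_currified; lra.
      - change (fun s : R => radicand A B C s) with (radicand A B C).
        rewrite (is_derive_unique _ _ _ HdF); field; lra. }
  replace (Derive (fibre (ansatz A B C v)) r) with
    ((2 * r * radicand A B C r + r ^ 2 * radicand' A B C r) / 4).
  2:{ symmetry; apply is_derive_unique; cbn -[pow]; auto_derive.
      - eexists; exact HdF.
      - change (fun s : R => radicand A B C s) with (radicand A B C).
        rewrite (is_derive_unique _ _ _ HdF); field. }
  cbn; field; repeat split; trivial; try lra.
Qed.

Lemma Derive_base_flux (A B C : R) (v : R -> R) (r : R) : 0 < B ->
  rdom A B C r ->
  Derive (fun s => Derive (base (ansatz A B C v)) s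
                   / (2 * grr (ansatz A B C v) s)) r
  = ((1 + 3 * B * r ^ 2) * radicand A B C r
     + r * (1 + B * r ^ 2) * radicand' A B C r) / 4.
Proof.
  intros HB Hr; assert (HdF := is_derive_radicand A B C r HB (proj1 Hr)).
  rewrite (Derive_ext_loc _
    (fun s => s * ((1 + B * s ^ 2) * radicand A B C s) / 4)).
  - apply is_derive_unique; auto_derive.
    + eexists; exact HdF.
    + change (fun s : R => radicand A B C s) with (radicand A B C).
      rewrite (is_derive_unique _ _ _ HdF); field.
  - refine (filter_imp _ _ _ (rdom_open A B C r HB Hr)); intros s [Hs HF].
    assert (Hw := warp_pos B s HB).
    replace (Derive _ s) with (s / 2)
      by (symmetry; apply is_derive_unique; cbn; auto_derive; trivial; field).
    cbn -[pow]; field; lra.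
Qed.

(** The numerator of [v' / v] in [lapse_ode]. *)
Definition lapse_num (A B lam r : R) : R := B * A - (lam + 3 * B) * r ^ 4.

(** The part of the theta-theta equation without [v], multiplied by [4] and with
    [F] inserted.  The terms in [C] cancel because [x / r^4] solves the
    homogeneous equation [3 B r^2 u + 4 u + x^2 r u' = 0]. *)
Lemma angular_source (A B C lam r : R) : 0 < B -> 0 < r ->
  - lam * r ^ 2 - 3 * B * r ^ 2 * radicand A B C r + 4 * (1 - radicand A B C r)
  - (1 + B * r ^ 2) * r * radicand' A B C r
  = lapse_num A B lam r / r ^ 2.
Proof.
  intros HB Hr; unfold lapse_num, radicand, radicand'.
  assert (Hs := warp_pos B r HB); assert (Hx := sqrt_lt_R0 _ Hs).
  assert (Hx2 := sqrt_sqrt _ (Rlt_le _ _ Hs)).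
  revert Hx Hx2; generalize (sqrt (1 + B * r ^ 2)); intros x Hx Hx2.
  (* Eliminating B leaves an identity of rational functions in x and r. *)
  replace B with ((x * x - 1) / r ^ 2) by (rewrite Hx2; field; lra).
  field; lra.
Qed.

(** The theta-theta equation at the equator, solved for [v']. *)
Lemma lapse_ode (A B C lam : R) (v : R -> R) (r : R) : 0 < B ->
  einstein_on (chart A B C) (gtilde A B C v) lam ->
  (forall s, rdom A B C s -> v s <> 0 /\ ex_derive v s) -> rdom A B C r ->
  Derive v r =
  v r * lapse_num A B lam r / (r ^ 3 * ((1 + B * r ^ 2) * radicand A B C r)).
Proof.
  intros HB (ginv & Hinv & HE) Hv Hr.
  pose (x := equator r); assert (Hx : chart A B C x) by now apply equator_chart.
  assert (E := HE x Hx 2%nat 2%nat ltac:(lia) ltac:(lia)).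
  rewrite (ricci_biaxial_thth _ (ansatz A B C v) _ _ _
    (fun s => rdom_open A B C s HB) (regular_ansatz A B C v HB Hv)
    (gtilde_biaxial A B C v) Hinv Hx eq_refl) in E.
  rewrite (gtilde_biaxial A B C v x Hx) in E by lia.
  cbv zeta in E; change (x rcoord) with r in E.
  destruct (Hv r Hr) as [Hv0 Hv1].
  rewrite Derive_base_flux, Derive_base, log_volume'_ansatz in E by trivial.
  destruct Hr as [Hr HF].
  assert (Hs := warp_pos B r HB).
  cbn -[pow] in E.
  assert (EK : Derive v r / v r * (r * ((1 + B * r ^ 2) * radicand A B C r))
               = lapse_num A B lam r / r ^ 2).
  { rewrite <- (angular_source A B C lam r HB Hr).
    apply Rminus_diag_uniq.
    match type of E with ?lhs = ?rhs => transitivity (4 * (rhs - lhs)) end.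
    - field; repeat split; trivial; lra.
    - rewrite E; ring. }
  apply (Rmult_eq_reg_r (r * ((1 + B * r ^ 2) * radicand A B C r) / v r)).
  - transitivity (lapse_num A B lam r / r ^ 2); [rewrite <- EK|];
      field; repeat split; trivial; lra.
  - apply Rmult_integral_contrapositive_currified;
      [|now apply Rinv_neq_0_compat].
    apply Rgt_not_eq; repeat apply Rmult_lt_0_compat; trivial.
Qed.

(** The tt equation is [(r^3 / x * x^2 F v')' = - lam r^3 / x * v].  By [lapse_ode]
    the flux [v v' x^2 F] is [v^2 lapse_num / r^3], so its derivative is computed
    without second derivatives of [v], and a factor [v^2] splits off.  The
    equation is stated after division by [r^8], in powers of [1 / r]. *)
Lemma time_constraint (A B C lam : R) (v : R -> R) (r : R) : 0 < B ->
  einstein_on (chart A B C) (gtilde A B C v) lam ->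
  (forall s, rdom A B C s -> v s <> 0 /\ ex_derive v s) -> rdom A B C r ->
  radicand A B C r *
    ((lam - 3 * (lam + 3 * B)) * B + (lam - 4 * (lam + 3 * B)) / r ^ 2
     - B ^ 2 * A / r ^ 4)
  + (B * A / r ^ 4 - (lam + 3 * B)) ^ 2 = 0.
Proof.
  intros HB HE Hv Hr.
  assert (Hode := fun s => lapse_ode A B C lam v s HB HE Hv).
  destruct HE as (ginv & Hinv & HE).
  pose (x := equator r); assert (Hx : chart A B C x) by now apply equator_chart.
  assert (E := HE x Hx 0%nat 0%nat ltac:(lia) ltac:(lia)).
  rewrite (ricci_biaxial_tt _ (ansatz A B C v) _ _ _
    (fun s => rdom_open A B C s HB) (regular_ansatz A B C v HB Hv)
    (gtilde_biaxial A B C v) Hinv Hx) in E.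
  rewrite (gtilde_biaxial A B C v x Hx) in E by lia.
  cbv zeta in E; change (x rcoord) with r in E.
  destruct (Hv r Hr) as [Hv0 Hv1].
  rewrite Derive_gtt, log_volume'_ansatz in E by trivial.
  assert (Hflux : Derive (fun s => Derive (gtt (ansatz A B C v)) s
                                   / (2 * grr (ansatz A B C v) s)) r
    = - (2 * v r * Derive v r * lapse_num A B lam r / r ^ 3
         - v r ^ 2 * (3 * B * A + (lam + 3 * B) * r ^ 4) / r ^ 4)).
  { rewrite (Derive_ext_loc _
      (fun s => - (v s ^ 2 * lapse_num A B lam s / s ^ 3))).
    - apply is_derive_unique; unfold lapse_num; auto_derive.
      + destruct Hr; repeat split; trivial; apply Rgt_not_eq.
        repeat apply Rmult_lt_0_compat; lra.
      + change (fun s : R => v s) with v; destruct Hr; field; lra.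
    - refine (filter_imp _ _ _ (rdom_open A B C r HB Hr)); intros s Hs.
      destruct (Hv s Hs) as [Hs0 Hs1].
      rewrite Derive_gtt, (Hode s) by trivial; destruct Hs as [Hs HF].
      assert (Hw := warp_pos B s HB).
      cbn -[pow]; field; lra. }
  rewrite Hflux, (Hode r Hr) in E; clear Hflux Hode.
  destruct Hr as [Hr HF]; assert (Hs := warp_pos B r HB).
  cbn -[pow] in E.
  set (F := radicand A B C r) in *.
  apply Rminus_diag_eq in E.
  apply (Rmult_eq_reg_l (v r ^ 2 * r ^ 2 / ((1 + B * r ^ 2) * F))).
  - transitivity 0; [rewrite <- E|ring].
    unfold lapse_num; field; repeat split; trivial; lra.
  - assert (0 < v r ^ 2)
      by (generalize (pow_nonzero _ 2 Hv0) (pow2_ge_0 (v r)); lra).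
    apply Rgt_not_eq, Rdiv_lt_0_compat; apply Rmult_lt_0_compat; trivial.
    now apply pow_lt.
Qed.

(** * Behaviour at large radius *)

(** The radicand at [r = 1 / w].  As [x / r^4 = w^3 sqrt (w^2 + B)], it extends
    smoothly to [w = 0], and limits at infinity become values at [0]. *)
Definition radicand_at_inv (A B C w : R) : R :=
  1 + C * (w ^ 3 * sqrt (w ^ 2 + B)) + A * w ^ 4.

Lemma radicand_inv (A B C w : R) : 0 < B -> 0 < w ->
  radicand A B C (/ w) = radicand_at_inv A B C w.
Proof.
  intros HB Hw; unfold radicand, radicand_at_inv.
  replace (1 + B * (/ w) ^ 2) with ((w ^ 2 + B) / w ^ 2) by (field; lra).
  assert (Hw2 : 0 < w ^ 2) by now apply pow_lt.
  rewrite sqrt_div_alt by trivial.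
  rewrite sqrt_pow2 by lra.
  field; lra.
Qed.

Lemma continuous_radicand_at_inv (A B C : R) : 0 < B ->
  continuous (radicand_at_inv A B C) 0.
Proof.
  intros HB; apply (ex_derive_continuous (radicand_at_inv A B C)).
  unfold radicand_at_inv; auto_derive; lra.
Qed.

Lemma rdom_at_infinity (A B C : R) : 0 < B ->
  locally 0 (fun w => 0 < w -> rdom A B C (/ w)).
Proof.
  intros HB.
  assert (H0 : 0 < radicand_at_inv A B C 0)
    by (unfold radicand_at_inv; simpl; lra).
  assert (Hloc : locally 0 (fun w => 0 < radicand_at_inv A B C w))
    by exact (continuous_radicand_at_inv A B C HB _ (open_gt 0 _ H0)).
  refine (filter_imp _ _ _ Hloc).
  intros w HF Hw; split; [now apply Rinv_0_lt_compat|].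
  now rewrite radicand_inv.
Qed.

Lemma locally_right_ex (P : R -> Prop) :
  locally 0 (fun w => 0 < w -> P w) -> exists w, 0 < w /\ P w.
Proof.
  intros [e He]; assert (Hpos := cond_pos e).
  exists (e / 2); split; [lra|].
  apply He; [|lra].
  unfold ball; simpl; unfold AbsRing_ball, abs, minus, plus, opp; simpl.
  rewrite Rabs_right; lra.
Qed.

Lemma continuous_zero_from_right (h : R -> R) : continuous h 0 ->
  locally 0 (fun w => 0 < w -> h w = 0) -> h 0 = 0.
Proof.
  intros Hh Hz; destruct (Req_dec (h 0) 0) as [|Hn]; trivial.
  destruct (locally_right_ex (fun w => h w = 0 /\ h w <> 0)) as (w & _ & E & N).
  - assert (Hloc : locally 0 (fun w => h w <> 0))
      by exact (Hh _ (open_neq 0 _ Hn)).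
    refine (filter_imp _ _ _ (filter_and _ _ Hz Hloc)).
    intros w [H1 H2] Hw; auto.
  - now contradict N.
Qed.

(** At [w = 1 / r = 0] the radicand is [1], so only [a] and [m] survive in the
    limit. *)
Lemma asymptotic_constraint (A B C a b c d m : R) : 0 < B ->
  (forall r, rdom A B C r ->
     radicand A B C r * (a + b / r ^ 2 + c / r ^ 4) + (d / r ^ 4 - m) ^ 2 = 0) ->
  a + m ^ 2 = 0.
Proof.
  intros HB H.
  pose (h := fun w => radicand_at_inv A B C w * (a + b * w ^ 2 + c * w ^ 4)
                      + (d * w ^ 4 - m) ^ 2).
  assert (H0 : h 0 = 0).
  { apply continuous_zero_from_right.
    - apply (ex_derive_continuous h).
      unfold h, radicand_at_inv; auto_derive; lra.
    - refine (filter_imp _ _ _ (rdom_at_infinity A B C HB)); intros w Hd Hw.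
      rewrite <- (H _ (Hd Hw)), radicand_inv by trivial.
      unfold h; field; lra. }
  rewrite <- H0; unfold h, radicand_at_inv; ring.
Qed.

(** * Determination of the lapse *)

(** Nondegeneracy of the metric: its tt row is [(- v^2, 0, 0, 0, 0)]. *)
Lemma lapse_nonzero (A B C lam : R) (v : R -> R) (r : R) :
  einstein_on (chart A B C) (gtilde A B C v) lam -> rdom A B C r -> v r <> 0.
Proof.
  intros (ginv & Hinv & _) Hr Hv.
  pose (x := equator r); assert (Hx : chart A B C x) by now apply equator_chart.
  assert (E := Hinv x Hx 0%nat 0%nat ltac:(lia) ltac:(lia)).
  rewrite (sum5_ext _ (fun k => biaxial (ansatz A B C v) 0 k r (PI / 2) * ginv x k 0%nat))
    in E by (intros k Hk; now rewrite (gtilde_biaxial A B C v x Hx) by lia).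
  cbn in E; rewrite Hv in E; lra.
Qed.

(** The differential condition is [v' / v = u' / u] cleared of denominators, the
    vanishing of the numerator of [(v / u)']. *)
Lemma constant_of_log_derivative (v u : R -> R) (r0 r1 : R) :
  r0 <= r1 ->
  (forall r, r0 <= r <= r1 -> 0 < u r /\ ex_derive v r /\ ex_derive u r /\
     Derive v r * u r = v r * Derive u r) ->
  v r0 / u r0 = v r1 / u r1.
Proof.
  intros [Hlt| ->] H; [|reflexivity].
  apply (eq_is_derive (fun s => v s / u s)); trivial.
  intros r Hr; destruct (H r Hr) as (Hu & Ev & Eu & E).
  change zero with 0; auto_derive.
  - repeat split; trivial; lra.
  - change (fun s : R => v s) with v; change (fun s : R => u s) with u.
    transitivity ((Derive v r * u r - v r * Derive u r) / u r ^ 2);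
      [field; lra|rewrite E; field; lra].
Qed.

Theorem theorem4p2 (A B C Lambda : R) (v : R -> R)
  (hB : 0 < B) (hLambda : Lambda < 0)
  (hv : smooth_on (rdom A B C) v)
  (hE : einstein_on (chart A B C) (gtilde A B C v) (2 / 3 * Lambda)) :
  (exists c : R, c <> 0 /\
     forall r : R, rdom A B C r -> v r = c * sqrt (1 + B * r ^ 2)) /\
  C = 0.
Proof.
  set (lam := 2 / 3 * Lambda) in *.
  assert (Hlam : lam < 0) by (unfold lam; lra).
  assert (Hv : forall s, rdom A B C s -> v s <> 0 /\ ex_derive v s)
    by (intros s Hs; split; [now apply (lapse_nonzero A B C lam)|exact (hv 1%nat s Hs)]).
  assert (Hc := fun s => time_constraint A B C lam v s hB hE Hv).
  assert (HL : lam = - 4 * B).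
  { assert (Q : (lam - 3 * (lam + 3 * B)) * B + (lam + 3 * B) ^ 2 = 0).
    { apply (asymptotic_constraint A B C _ (lam - 4 * (lam + 3 * B))
               (- (B ^ 2 * A)) (B * A)); trivial.
      intros s Hs; rewrite <- (Hc s Hs); unfold Rdiv; ring. }
    assert (lam * (lam + 4 * B) = 0) by lra.
    destruct (Rmult_integral _ _ H); lra. }
  assert (HC : C = 0).
  { (* The relation at one radius suffices, provided 1 + A / r^4 > 0 there. *)
    destruct (locally_right_ex (fun w => rdom A B C (/ w) /\ 0 < radicand_at_inv A B 0 w))
      as (w & Hw & Hd & HA).
    - refine (filter_imp _ _ _ (filter_and _ _ (rdom_at_infinity A B C hB)
        (rdom_at_infinity A B 0 hB))).
      intros w [H1 H2] Hw; split; [now apply H1|].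
      rewrite <- radicand_inv by trivial; now apply H2.
    - assert (E := Hc _ Hd); rewrite radicand_inv in E by trivial.
      unfold radicand_at_inv in *; rewrite HL in E.
      assert (Hx : 0 < w ^ 3 * sqrt (w ^ 2 + B)).
      { apply Rmult_lt_0_compat; [now apply pow_lt|].
        apply sqrt_lt_R0; generalize (pow2_ge_0 w); lra. }
      revert E HA Hx; generalize (w ^ 3 * sqrt (w ^ 2 + B)); intros y E HA Hy.
      assert (E' : B ^ 2 * y * (1 + 0 * y + A * w ^ 4) * C = 0).
      { match type of E with ?e = 0 => transitivity (- e) end;
          [field; lra|rewrite E; ring]. }
      apply Rmult_integral in E'; destruct E' as [E'|]; trivial.
      exfalso; revert E'; apply Rgt_not_eq.
      repeat apply Rmult_lt_0_compat; trivial; lra. }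
  split; [|exact HC].
  (* The domain is upward closed: an interval. *)
  assert (Hup : forall r s, rdom A B C r -> r <= s -> rdom A B C s).
  { rewrite HC; intros r s [Hr HF] Hrs; split; [lra|].
    unfold radicand in *.
    assert (0 < r ^ 4) by now apply pow_lt.
    assert (r ^ 4 <= s ^ 4) by (apply pow_incr; lra).
    replace (1 + sqrt (1 + B * r ^ 2) * 0 / r ^ 4 + A / r ^ 4)
      with ((r ^ 4 + A) / r ^ 4) in HF by (field; lra).
    replace (1 + sqrt (1 + B * s ^ 2) * 0 / s ^ 4 + A / s ^ 4)
      with ((s ^ 4 + A) / s ^ 4) by (field; lra).
    assert (0 < r ^ 4 + A)
      by (replace (r ^ 4 + A) with ((r ^ 4 + A) / r ^ 4 * r ^ 4) by (field; lra);
          now apply Rmult_lt_0_compat).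
    apply Rdiv_lt_0_compat; lra. }
  pose (x := fun r => sqrt (1 + B * r ^ 2)).
  assert (Hx : forall r, 0 < x r) by (intros r; apply sqrt_lt_R0, warp_pos, hB).
  assert (Hratio : forall r s, rdom A B C r -> r <= s -> v r / x r = v s / x s).
  { intros r s Hr Hrs; apply (constant_of_log_derivative v x); trivial.
    intros q [Hq _]; assert (Hd := Hup r q Hr Hq).
    destruct (Hv q Hd) as [Hq0 Hq1].
    assert (Hw := warp_pos B q hB).
    assert (Hxq : is_derive x q (B * q / x q)).
    { unfold x; auto_derive; [exact Hw|].
      change (q * (q * 1)) with (q ^ 2); field; apply Rgt_not_eq, Hx. }
    repeat split; trivial; [eexists; exact Hxq|].
    rewrite (lapse_ode A B C lam v q hB hE Hv Hd), (is_derive_unique _ _ _ Hxq).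
    assert (Hx2 : x q * x q = 1 + B * q ^ 2) by (apply sqrt_sqrt; lra).
    rewrite <- Hx2; assert (Hxq0 := Hx q); destruct Hd as [Hq' HF].
    assert (EK : lapse_num A B lam q = B * q ^ 4 * radicand A B C q)
      by (unfold lapse_num, radicand; rewrite HL, HC; field; lra).
    rewrite EK; field; lra. }
  destruct (locally_right_ex _ (rdom_at_infinity A B C hB)) as (w & _ & Hd).
  set (r0 := / w) in *.
  exists (v r0 / x r0); split.
  - apply Rmult_integral_contrapositive_currified; [now apply Hv|].
    apply Rinv_neq_0_compat, Rgt_not_eq, Hx.
  - intros r Hr.
    replace (v r0 / x r0) with (v r / x r).
    + change (sqrt (1 + B * r ^ 2)) with (x r).
      field; apply Rgt_not_eq, Hx.
    + destruct (Rle_or_lt r r0) as [Hle|Hlt]; [now apply Hratio|].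
      symmetry; apply Hratio; lra || trivial.
Qed.
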